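(* Let $0<\alpha<1/3$. There is a constant $c_\alpha>0$ depending only on $\alpha$ such that the following holds for all integers $n,T\ge1$ and all $\Delta_F,L>0$. Let $F(\mathbf{x})=\frac1n\sum_{i=1}^n f_i(\mathbf{x})$ on $\mathbb{R}^d$, where each $f_i:\mathbb{R}^d\to\mathbb{R}$ is differentiable with $\|\nabla f_i(\mathbf{x})-\nabla f_i(\mathbf{y})\|\le L\|\mathbf{x}-\mathbf{y}\|$ for all $\mathbf{x},\mathbf{y}$ and $i\in\{1,\dots,n\}$, and suppose $F_*=\inf_{\mathbf{x}}F(\mathbf{x})>-\infty$ and $F(\mathbf{x}_1)-F_*\le\Delta_F$ for the initial point $\mathbf{x}_1$. Let $\mathbf{x}_1,\dots,\mathbf{x}_T$ be the iterates of the SAG-type finite-sum STORM algorithm (described in the context) with $$\eta_t=\frac{1}{n^{\frac{1-\alpha}{2}}\left(\sum_{i=1}^t\|\mathbf{v}_i\|^2\right)^{\alpha}},\qquad\beta=\frac1n,$$ and let $\tau$ be uniform on $\{1,\dots,T\}$, independent of everything else. Then $$\mathbb{E}\left[\|\nabla F(\mathbf{x}_\tau)\|\right]\le c_\alpha\,\frac{n^{1/4}}{T^{1/2}}\left(\Delta_F^{\frac{1}{2(1-\alpha)}}+L^{\frac{1}{2\alpha}}\right).$$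
   Context: SAG-type finite-sum STORM with (deterministic) initial point $\mathbf{x}_1\in\mathbb{R}^d$. At each step $t$ an index $i_t$ is drawn uniformly from $\{1,\dots,n\}$, independently of the past. A full batch is used in the first iteration: $\mathbf{v}_1=\nabla F(\mathbf{x}_1)$ and $g_1^i=\nabla f_i(\mathbf{x}_1)$ for all $i$. For $t\ge2$, $$\mathbf{v}_t=(1-\beta)\mathbf{v}_{t-1}+\nabla f_{i_t}(\mathbf{x}_t)-(1-\beta)\nabla f_{i_t}(\mathbf{x}_{t-1})-\beta\Big(g_t^{i_t}-\frac1n\sum_{i=1}^n g_t^i\Big).$$ For every $t\ge1$: $g_{t+1}^{i}=\nabla f_{i_t}(\mathbf{x}_t)$ if $i=i_t$ and $g_{t+1}^i=g_t^i$ if $i\ne i_t$; and $\mathbf{x}_{t+1}=\mathbf{x}_t-\eta_t\mathbf{v}_t$ (with $\eta_t\mathbf{v}_t$ read as $0$ if $\sum_{i\le t}\|\mathbf{v}_i\|^2=0$). The expectation is over the indices and over $\tau$. *)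

(* Defs.v *)
From HB Require Import structures.
From mathcomp Require Import all_boot all_order all_algebra.
From mathcomp Require Import all_classical all_reals all_analysis.

Set Implicit Arguments.
Unset Strict Implicit.
Unset Printing Implicit Defensive.

Import Order.TTheory GRing.Theory Num.Theory.
Import numFieldNormedType.Exports.

Local Open Scope classical_set_scope.
Local Open Scope ring_scope.

(** The library norm [`|x|] on ['rV[R]_d] is the sup norm, hence a separate
    Euclidean norm.  (Differentiability does not depend on this choice.) *)
Definition norm2 (R : realType) (d : nat) (x : 'rV[R]_d) : R :=
  Num.sqrt (\sum_(j < d) x 0 j ^+ 2).

Definition grad (R : realType) (d : nat) (f : 'rV[R]_d -> R) (x : 'rV[R]_d) :
    'rV[R]_d :=
  \row_(j < d) 'D_(delta_mx 0 j) f x.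

Definition average (R : realType) (n d : nat) (f : 'I_n -> 'rV[R]_d -> R)
    (x : 'rV[R]_d) : R :=
  n%:R^-1 * \sum_(i < n) f i x.

(** [storm_x], [storm_v], [storm_g] and [storm_sum] hold, for the state at
    time t >= 1, x_t, v_t, (g_t^i)_i and \sum_(i <= t) |v_i|^2. *)
Record storm_state (R : realType) (n d : nat) := StormState {
  storm_x : 'rV[R]_d;
  storm_v : 'rV[R]_d;
  storm_g : 'I_n -> 'rV[R]_d;
  storm_sum : R
}.

Definition storm_init (R : realType) (n d : nat) (f : 'I_n -> 'rV[R]_d -> R)
    (x1 : 'rV[R]_d) : storm_state R n d :=
  {| storm_x := x1;
     storm_v := grad (average f) x1;
     storm_g := fun i => grad (f i) x1;
     storm_sum := norm2 (grad (average f) x1) ^+ 2 |}.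

(** From time t to time t + 1, where [i] is i_t and [j] is i_(t+1).  The step
    size eta_t is given as a function [eta] of \sum_(i <= t) |v_i|^2. *)
Definition storm_step (R : realType) (n d : nat) (f : 'I_n -> 'rV[R]_d -> R)
    (eta : R -> R) (beta : R) (i j : 'I_n) (s : storm_state R n d) :
    storm_state R n d :=
  let x := storm_x s in
  let x' := if storm_sum s == 0 then x
            else x - eta (storm_sum s) *: storm_v s in
  let g' := fun k => if k == i then grad (f i) x else storm_g s k in
  let v' := (1 - beta) *: storm_v s + grad (f j) x'
            - (1 - beta) *: grad (f j) x
            - beta *: (g' j - n%:R^-1 *: \sum_(k < n) g' k) in
  {| storm_x := x'; storm_v := v'; storm_g := g';
     storm_sum := storm_sum s + norm2 v' ^+ 2 |}.

(** Time is counted from 0: [storm k] is the state at time t = k + 1, and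
    [idx k] is the index i_(k+1). *)
Fixpoint storm (R : realType) (n d : nat) (f : 'I_n -> 'rV[R]_d -> R)
    (eta : R -> R) (beta : R) (x1 : 'rV[R]_d) (idx : nat -> 'I_n) (k : nat) :
    storm_state R n d :=
  match k with
  | 0%N => storm_init f x1
  | k'.+1 => storm_step f eta beta (idx k') (idx k'.+1)
               (storm f eta beta x1 idx k')
  end.

(** Random variables with values in a finite type, for its discrete
    sigma-algebra. *)
Definition uniform_rv (disp : measure_display) (Omega : measurableType disp)
    (R : realType) (P : probability Omega R) (A : finType) (X : Omega -> A) :
    Prop :=
  (forall U : set A, measurable (X @^-1` U)) /\
  (forall a : A, P (X @^-1` [set a]) = (#|A|%:R^-1)%:E).

Definition independent_rv (disp : measure_display) (Omega : measurableType disp)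
    (R : realType) (P : probability Omega R) (A B : finType)
    (X : Omega -> A) (Y : Omega -> B) : Prop :=
  forall (U : set A) (V : set B),
    P (X @^-1` U `&` Y @^-1` V) = (P (X @^-1` U) * P (Y @^-1` V))%E.

Definition history (Omega : Type) (n : nat) (idx : nat -> Omega -> 'I_n)
    (k : nat) (w : Omega) : {ffun 'I_k -> 'I_n} :=
  [ffun s : 'I_k => idx s w].

(* Main.v *)
(* Let e_k = v_k - grad F(x_k).  Its conditional second moment contracts by the
   factor (1 - 1/n)^2, up to a term in |x_(k+1) - x_k|^2 and the mean square lag of
   the stored gradients, which itself contracts by 1 - 1/(2n).  Because the step size
   eta_k is nonincreasing and known before the index i_(k+1) is drawn, both recurrences
   survive multiplication by eta_k, and the potential n e + 4 lag gives
     E sum eta_k |e_k|^2 <= 10 n L^2 E sum eta_k^3 |v_k|^2.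
   With S = sum |v_k|^2 and eta_k = 1 / (kappa S_k^alpha), the right-hand side is at
   most a multiple of S^(1 - 3 alpha), which is where alpha < 1/3 is needed.  Inserted
   in the descent lemma and absorbed by Young's inequality, this bounds
   E S^(1 - alpha) and E sum |grad F(x_k)|^2 S_k^(-alpha), and a last weighted AM-GM
   recovers E |grad F(x_tau)|.  If grad F(x_1) = 0 the iterates never move.

   The law of the indices is uniform on a finite function space, and conditioning on
   the past is replaced there by resampling one coordinate. *)

Require Import Defs.
From HB Require Import structures.
From mathcomp Require Import all_boot all_order all_algebra.
From mathcomp Require Import all_classical all_reals all_analysis.
From mathcomp Require Import measurable_realfun ring lra.

Set Implicit Arguments.
Unset Strict Implicit.
Unset Printing Implicit Defensive.

Import Order.TTheory GRing.Theory Num.Theory.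
Import numFieldNormedType.Exports.

Local Open Scope classical_set_scope.
Local Open Scope ring_scope.

(** * Euclidean norm and finite means *)

Definition dotp (R : realType) (d : nat) (u v : 'rV[R]_d) : R :=
  \sum_(j < d) u 0 j * v 0 j.

Section Euclidean.
Variables (R : realType) (d : nat).
Implicit Types (u v w : 'rV[R]_d) (a b c : R).

Lemma sqr_norm2 u : norm2 u ^+ 2 = dotp u u.
Proof.
rewrite /norm2 sqr_sqrtr; first by apply: eq_bigr => j _; rewrite expr2.
by apply: sumr_ge0 => j _; exact: sqr_ge0.
Qed.

Lemma norm2_ge0 u : 0 <= norm2 u. Proof. exact: sqrtr_ge0. Qed.

Lemma norm2_0 : norm2 (0 : 'rV[R]_d) = 0.
Proof. by rewrite /norm2 big1 ?sqrtr0// => j _; rewrite mxE expr0n. Qed.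

Lemma norm2_sqr_eq0 u : norm2 u ^+ 2 = 0 -> u = 0.
Proof.
rewrite sqr_norm2 => /eqP; rewrite psumr_eq0; last first.
  by move=> j _; rewrite -expr2 sqr_ge0.
move=> /allP u0; apply/rowP => j; rewrite mxE; apply/eqP.
by have := u0 j (mem_index_enum j); rewrite /= mulf_eq0 orbb.
Qed.

Lemma dotpC u v : dotp u v = dotp v u.
Proof. by apply: eq_bigr => j _; rewrite mulrC. Qed.

Lemma dotpDl u v w : dotp (u + v) w = dotp u w + dotp v w.
Proof. by rewrite -big_split; apply: eq_bigr => j _; rewrite mxE mulrDl. Qed.

Lemma dotpZl a u v : dotp (a *: u) v = a * dotp u v.
Proof. by rewrite mulr_sumr; apply: eq_bigr => j _; rewrite mxE mulrA. Qed.

Lemma dotpBl u v w : dotp (u - v) w = dotp u w - dotp v w.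
Proof. by rewrite -scaleN1r dotpDl dotpZl mulN1r. Qed.

Lemma dotpZr a u v : dotp u (a *: v) = a * dotp u v.
Proof. by rewrite dotpC dotpZl dotpC. Qed.

Lemma dotp_suml (I : finType) (F : I -> 'rV[R]_d) w :
  dotp (\sum_i F i) w = \sum_i dotp (F i) w.
Proof.
rewrite exchange_big; apply: eq_bigr => j _.
by rewrite summxE mulr_suml.
Qed.

Lemma norm2Z_sqr a u : norm2 (a *: u) ^+ 2 = a ^+ 2 * norm2 u ^+ 2.
Proof. by rewrite !sqr_norm2 dotpZl dotpZr mulrA expr2. Qed.

Lemma norm2D_sqr u v :
  norm2 (u + v) ^+ 2 = norm2 u ^+ 2 + 2 * dotp u v + norm2 v ^+ 2.
Proof.
rewrite !sqr_norm2 dotpDl (dotpC u) (dotpC v (u + v)) !dotpDl (dotpC v u); ring.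
Qed.

Lemma norm2B_sqr u v :
  norm2 (u - v) ^+ 2 = norm2 u ^+ 2 - 2 * dotp u v + norm2 v ^+ 2.
Proof.
by rewrite -scaleN1r norm2D_sqr dotpZr norm2Z_sqr sqrrN expr1n mul1r mulN1r mulrN.
Qed.

Lemma norm2N u : norm2 (- u) = norm2 u.
Proof.
by congr Num.sqrt; apply: eq_bigr => j _; rewrite mxE sqrrN.
Qed.

Lemma ler_dotp c u v : 0 < c ->
  2 * dotp u v <= c * norm2 u ^+ 2 + c^-1 * norm2 v ^+ 2.
Proof.
move=> c0; rewrite -subr_ge0.
have -> : c * norm2 u ^+ 2 + c^-1 * norm2 v ^+ 2 - 2 * dotp u v =
    c^-1 * norm2 (c *: u - v) ^+ 2.
  rewrite norm2B_sqr norm2Z_sqr dotpZl; field; exact: lt0r_neq0.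
by rewrite mulr_ge0 ?invr_ge0 ?sqr_ge0 ?ltW.
Qed.

Lemma ler_norm2D_sqr c u v : 0 < c ->
  norm2 (u + v) ^+ 2 <= (1 + c) * norm2 u ^+ 2 + (1 + c^-1) * norm2 v ^+ 2.
Proof. by move=> c0; rewrite norm2D_sqr; have := ler_dotp u v c0; lra. Qed.

End Euclidean.

(** Expectation under the uniform law on [A]; [expectation_uniform] brings the probabilistic claim
    down to such finite sums. *)
Definition mean (R : realType) (A : finType) (phi : A -> R) : R :=
  #|A|%:R^-1 * \sum_a phi a.

Section Mean.
Variable R : realType.

Lemma ler_mean (A : finType) (phi psi : A -> R) :
  (forall a, phi a <= psi a) -> mean phi <= mean psi.
Proof.
by move=> le; rewrite ler_wpM2l ?invr_ge0//; apply: ler_sum => a _; exact: le.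
Qed.

Lemma eq_mean (A : finType) (phi psi : A -> R) : phi =1 psi -> mean phi = mean psi.
Proof. by move=> e; congr (_ * _); apply: eq_bigr => a _; exact: e. Qed.

Lemma mean_ge0 (A : finType) (phi : A -> R) : (forall a, 0 <= phi a) -> 0 <= mean phi.
Proof. by move=> p; rewrite mulr_ge0 ?invr_ge0//; apply: sumr_ge0. Qed.

Lemma meanD (A : finType) (phi psi : A -> R) :
  mean (fun a => phi a + psi a) = mean phi + mean psi.
Proof. by rewrite /mean big_split mulrDr. Qed.

Lemma meanZ (A : finType) c (phi : A -> R) : mean (fun a => c * phi a) = c * mean phi.
Proof. by rewrite /mean -mulr_sumr mulrCA. Qed.

Lemma mean_sum (A : finType) m (phi : 'I_m -> A -> R) :
  mean (fun a => \sum_(k < m) phi k a) = \sum_(k < m) mean (phi k).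
Proof. by rewrite /mean exchange_big mulr_sumr. Qed.

Lemma mean_cst (A : finType) (a : A) (c : R) : mean (fun _ : A => c) = c.
Proof.
rewrite /mean sumr_const -[X in _ * X]mulr_natl mulrA mulVf ?mul1r//.
by rewrite pnatr_eq0 -lt0n; apply/card_gt0P; exists a.
Qed.

Lemma mean_pair (A B : finType) (phi : A * B -> R) :
  mean phi = mean (fun a => mean (fun b => phi (a, b))).
Proof.
rewrite meanZ /mean card_prod natrM invfM mulrA (mulrC #|B|%:R^-1).
rewrite (pair_bigA _ (fun a b => phi (a, b))) /=.
by congr (_ * _); apply: eq_bigr => -[].
Qed.

(** The centred terms average to zero, so the cross product with [a] disappears; centring lowers the
    second moment by [norm2 m ^+ 2]. *)
Lemma mean_norm2_center (d n : nat) (a : 'rV[R]_d) (X : 'I_n -> 'rV[R]_d) : (0 < n)%N ->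
  mean (fun j => norm2 (a + (X j - n%:R^-1 *: \sum_i X i)) ^+ 2) <=
  norm2 a ^+ 2 + mean (fun j => norm2 (X j) ^+ 2).
Proof.
move=> n0; set m := n%:R^-1 *: _.
have nu : n%:R != 0 :> R by rewrite pnatr_eq0 -lt0n.
have mE : \sum_i X i = n%:R *: m by rewrite scalerA mulfV// scale1r.
move: m mE => m mE.
have -> : mean (fun j => norm2 (a + (X j - m)) ^+ 2) =
    norm2 a ^+ 2 + mean (fun j => norm2 (X j) ^+ 2) - norm2 m ^+ 2.
  rewrite /mean card_ord.
  under eq_bigr do rewrite norm2D_sqr dotpC dotpBl norm2B_sqr.
  rewrite !big_split/= -!mulr_sumr !big_split/= !sumrN -!mulr_sumr.
  rewrite -!dotp_suml mE !sumr_const card_ord -!(scaler_nat n m) !dotpZl -!sqr_norm2.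
  by field.
by rewrite gerBl sqr_ge0.
Qed.

(** Jensen's inequality: the gap is the variance of [X]. *)
Lemma norm2_mean_sqr (d n : nat) (X : 'I_n -> 'rV[R]_d) : (0 < n)%N ->
  norm2 (n%:R^-1 *: \sum_i X i) ^+ 2 <= mean (fun j => norm2 (X j) ^+ 2).
Proof.
move=> n0; set m := n%:R^-1 *: _.
have nu : n%:R != 0 :> R by rewrite pnatr_eq0 -lt0n.
have mE : \sum_i X i = n%:R *: m by rewrite scalerA mulfV// scale1r.
move: m mE => m mE.
rewrite -subr_ge0.
have -> : mean (fun j => norm2 (X j) ^+ 2) - norm2 m ^+ 2 =
    mean (fun j => norm2 (X j - m) ^+ 2).
  rewrite /mean card_ord.
  under [in RHS]eq_bigr do rewrite norm2B_sqr.
  rewrite !big_split/= sumrN -!mulr_sumr -dotp_suml mE.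
  rewrite sumr_const card_ord !dotpZl -!sqr_norm2.
  by field.
by apply: mean_ge0 => j; exact: sqr_ge0.
Qed.

End Mean.

(** * Smooth functions *)

Section Smooth.
Variables (R : realType) (d : nat).
Implicit Types (f : 'rV[R]_d -> R) (x y u : 'rV[R]_d).

Lemma derive_grad f x u : differentiable f x -> 'D_u f x = dotp (grad f x) u.
Proof.
move=> df; rewrite deriveE// [in LHS](row_sum_delta u) linear_sum.
by apply: eq_bigr => j _; rewrite linearZ/= mxE deriveE// mulrC.
Qed.

Lemma grad_average n (f : 'I_n -> 'rV[R]_d -> R) x :
  (forall i, differentiable (f i) x) ->
  grad (average f) x = n%:R^-1 *: \sum_(i < n) grad (f i) x.
Proof.
move=> df; apply/rowP => j; rewrite !mxE summxE.
under [in RHS]eq_bigr do rewrite mxE.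
have dd i : derivable (f i) x (delta_mx 0 j) by exact: diff_derivable.
have -> : average f = n%:R^-1 *: \sum_(i < n) f i.
  by apply/funext => y; rewrite /average /= fct_sumE.
by rewrite deriveZ ?derive_sum//; exact: derivable_sum.
Qed.

Lemma differentiable_average n (f : 'I_n -> 'rV[R]_d -> R) x :
  (forall i, differentiable (f i) x) -> differentiable (average f) x.
Proof.
move=> df.
have -> : average f = n%:R^-1 *: \sum_(i < n) f i.
  by apply/funext => y; rewrite /average /= fct_sumE.
exact/differentiableZ/differentiable_sum.
Qed.

(** The difference quotient along the line is literally that of [f] at [x + t *: u] in the direction
    [u]. *)
Lemma is_derive_line f x u (t : R) : differentiable f (x + t *: u) ->
  is_derive t 1 (fun s => f (x + s *: u)) (dotp (grad f (x + t *: u)) u).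
Proof.
move=> df; rewrite -derive_grad//.
have E : (fun h : R => h^-1 *: ((fun s => f (x + s *: u)) (h *: (1:R) + t) -
      f (x + t *: u))) =
    (fun h : R => h^-1 *: (f (h *: u + (x + t *: u)) - f (x + t *: u))).
  by apply/funext => h; rewrite /= [h%:A]mulr1 scalerDl addrCA.
split; last by rewrite /derive E.
by rewrite /derivable E; exact: diff_derivable.
Qed.

(** The Lipschitz bound enters squared because Young's inequality [ler_dotp] takes the place of
    Cauchy-Schwarz. *)
Lemma descent f (L : R) x y : 0 < L ->
  (forall z, differentiable f z) ->
  (forall z w, norm2 (grad f z - grad f w) ^+ 2 <= L ^+ 2 * norm2 (z - w) ^+ 2) ->
  f y <= f x + dotp (grad f x) (y - x) + L / 2 * norm2 (y - x) ^+ 2.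
Proof.
move=> L0 df Lf; set u := y - x.
pose c := dotp (grad f x) u; pose q := L / 2 * norm2 u ^+ 2.
(* Nonincreasing on [0, 1]: its derivative is the pairing of [grad f (x + t *: u) - grad f x] with
   [u], minus [L * t * norm2 u ^+ 2]. *)
pose phi (t : R) := f (x + t *: u) - (t * c + t ^+ 2 * q).
have dphi (t : R) : is_derive t 1 phi
    (dotp (grad f (x + t *: u)) u - (c + 2 * t * q)).
  have ? := is_derive_line (df (x + t *: u)).
  apply: is_derive_eq.
  rewrite /GRing.scale /=; ring.
have : phi 1 <= phi 0.
  apply: (@ler0_derive1_nincr _ phi 0 1) => //.
  - move=> t; rewrite in_itv/= => /andP[t0 t1].
    rewrite derive1E; have [_ ->] := dphi t.
    (* This weight makes both terms of [ler_dotp] at most [L * t * norm2 u ^+ 2]. *)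
    have Lt : 0 < (L * t)^-1 by rewrite invr_gt0 mulr_gt0.
    have := ler_dotp (grad f (x + t *: u) - grad f x) u Lt.
    have := Lf (x + t *: u) x; rewrite addrAC subrr add0r norm2Z_sqr.
    rewrite -(ler_pM2l Lt) dotpBl -/c invrK.
    have -> : (L * t)^-1 * (L ^+ 2 * (t ^+ 2 * norm2 u ^+ 2)) = L * t * norm2 u ^+ 2.
      by field; rewrite !lt0r_neq0.
    by rewrite /q; lra.
  - by apply: derivable_within_continuous => t _; have [] := dphi t.
by rewrite /phi /= scale1r scale0r addr0 /u subrKC -/u /q /c; lra.
Qed.

End Smooth.

(** * Uniform variables on finite types *)

Section Uniform.
Variable R : realType.

Definition upd (I A : finType) (h : {ffun I -> A}) (k : I) (a : A) : {ffun I -> A} :=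
  [ffun m => if m == k then a else h m].

(* [(h, a) |-> (upd h k a, h k)] is an involution, so resampling one coordinate
   preserves the mean. *)
Lemma mean_upd (I A : finType) (k : I) (phi : {ffun I -> A} -> R) : (0 < #|A|)%N ->
  mean phi = mean (fun h => mean (fun a => phi (upd h k a))).
Proof.
move=> /card_gt0P[a0 _].
rewrite -(mean_pair (fun p : {ffun I -> A} * A => phi (upd p.1 k p.2))).
transitivity (mean (fun p : {ffun I -> A} * A => phi p.1)).
  by rewrite mean_pair; apply: eq_mean => h; rewrite /= (@mean_cst R A a0).
rewrite /mean; congr (_ * _); pose s (p : {ffun I -> A} * A) := (upd p.1 k p.2, p.1 k).
have sK : involutive s.
  move=> [h a]; rewrite /s /= ffunE eqxx; congr (_, _).
  by apply/ffunP => m; rewrite !ffunE; case: eqVneq => [->|].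
by rewrite (reindex_inj (inv_inj sK)).
Qed.

Variables (disp : measure_display) (Omega : measurableType disp)
  (P : probability Omega R).

(** The variable is a finite combination of indicators; nonnegativity lets the integral pass through
    the sum on measurability alone. *)
Lemma expectation_uniform (A : finType) (X : Omega -> A) (phi : A -> R) :
  uniform_rv P X -> (forall a, 0 <= phi a) ->
  ('E_P[fun w => phi (X w)] = (mean phi)%:E)%E.
Proof.
move=> [mX PX] phi0; rewrite unlock.
under eq_integral => w _.
  have -> : phi (X w) = \sum_a phi a * \1_(X @^-1` [set a]) w.
    rewrite (bigD1 (X w))//= big1; last first.
      move=> a aX; rewrite indicE; case: (boolP (w \in _)); last by rewrite mulr0.
      by rewrite inE => /= e; rewrite e eqxx in aX.
    by rewrite addr0 indicE mem_set ?mulr1.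
  rewrite -sumEFin.
  under eq_bigr do rewrite EFinM.
  over.
rewrite ge0_integral_sum//; last first.
- by move=> a w _; rewrite -EFinM lee_fin mulr_ge0.
- move=> a; apply: measurable_funeM.
  by apply/measurable_EFinP; exact: measurable_indic.
rewrite /mean mulr_sumr -sumEFin; apply: eq_bigr => a _.
rewrite ge0_integralZl_EFin//; last first.
- by apply/measurable_EFinP; exact: measurable_indic.
rewrite integral_indic// setIT [X in (_ * X)%E](PX a).
by rewrite -EFinM mulrC.
Qed.

Lemma uniform_rv_pair (A B : finType) (X : Omega -> A) (Y : Omega -> B) :
  uniform_rv P X -> uniform_rv P Y -> independent_rv P X Y ->
  uniform_rv P (fun w => (X w, Y w)).
Proof.
move=> [mX PX] [mY PY] XY; split=> [U|[a b]].
  have -> : (fun w => (X w, Y w)) @^-1` U =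
      \bigcup_(p in U) (X @^-1` [set p.1] `&` Y @^-1` [set p.2]).
    apply/seteqP; split=> [w Uw|w [[a b] Uab [/= aw bw]]]; first by exists (X w, Y w).
    by rewrite /= aw bw.
  by apply: fin_bigcup_measurable => // p _; exact: measurableI.
have -> : (fun w => (X w, Y w)) @^-1` [set (a, b)] =
    X @^-1` [set a] `&` Y @^-1` [set b].
  by apply/seteqP; split=> w /= [-> ->].
rewrite [LHS](XY [set a] [set b]); transitivity (#|A|%:R^-1%:E * #|B|%:R^-1%:E : \bar R)%E.
  by congr (_ * _)%E; [exact: PX | exact: PY].
by rewrite -EFinM card_prod natrM invfM.
Qed.

Lemma uniform_rv_inj (A B : finType) (X : Omega -> A) (g : A -> B) :
  injective g -> #|A| = #|B| -> uniform_rv P X -> uniform_rv P (g \o X).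
Proof.
move=> gi AB [mX PX]; split=> [U|b]; first by rewrite comp_preimage; exact: mX.
have [g' gK g'K] := inj_card_bij gi (eq_leq (esym AB)).
rewrite -AB -(PX (g' b)); congr (P _).
by apply/seteqP; split=> w /= => [<-|->].
Qed.

(** The new index is independent of the history so far, so the pair is uniform on the product, and
    appending the index is a bijection onto the longer sequences. *)
Lemma uniform_history (n T : nat) (idx : nat -> Omega -> 'I_n) :
  (forall k, (k < T)%N -> uniform_rv P (idx k)) ->
  (forall k, (k < T)%N -> independent_rv P (idx k) (history idx k)) ->
  uniform_rv P (history idx T).
Proof.
move=> idx_unif idx_indep; elim: T idx_unif idx_indep => [|T IH] U I.
  (* There is only one sequence of length zero, so every preimage is empty or full. *)
  have h0 w h : history idx 0 w = h by apply/ffunP => -[].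
  split=> [V|h].
    case: (pselect (exists w, V (history idx 0 w))) => [[w Vw]|nV].
      suff -> : history idx 0 @^-1` V = setT by [].
      by apply/seteqP; split=> // w' _ /=; rewrite (h0 w' (history idx 0 w)).
    suff -> : history idx 0 @^-1` V = set0 by [].
    by apply/seteqP; split=> // w Vw; apply: nV; exists w.
  have -> : history idx 0 @^-1` [set h] = setT.
    by apply/seteqP; split=> // w _ /=; exact: h0.
  by rewrite probability_setT card_ffun !card_ord expn0 invr1.
pose g (p : 'I_n * {ffun 'I_T -> 'I_n}) : {ffun 'I_T.+1 -> 'I_n} :=
  [ffun m => if unlift ord_max m is Some m' then p.2 m' else p.1].
have gi : injective g.
  move=> [i h] [i' h'] /ffunP e; congr (_, _).
    by have := e ord_max; rewrite !ffunE unlift_none.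
  by apply/ffunP => m; have := e (lift ord_max m); rewrite !ffunE liftK.
have -> : history idx T.+1 = g \o (fun w => (idx T w, history idx T w)).
  apply/funext => w; apply/ffunP => m; rewrite /= !ffunE.
  case: unliftP => [m'|] ->; last by [].
  by rewrite ffunE; congr (idx _ w); exact: lift_max.
apply: uniform_rv_inj => //.
  by rewrite card_prod !card_ffun !card_ord expnS.
apply: uniform_rv_pair; [exact: U | | exact: I].
by apply: IH => k kT; [apply: U | apply: I]; exact: ltnW.
Qed.

End Uniform.

(** * Power inequalities *)

Section PowerInequalities.
Variable R : realType.
Implicit Types (x y s t p q c : R).

Lemma powR_young x y t : 0 <= x -> 0 <= y -> 0 < t < 1 ->
  x `^ t * y `^ (1 - t) <= x + y.
Proof.
move=> x0 y0 /andP[t0 t1].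
have t1' : 0 < 1 - t by rewrite subr_gt0.
have := @conjugate_powR R (x `^ t) (y `^ (1 - t)) t^-1 (1 - t)^-1
  (powR_ge0 _ _) (powR_ge0 _ _).
rewrite !invr_gt0 !invrK subrKC => /(_ t0 t1' erefl) /le_trans; apply.
rewrite -!powRrM !mulfV ?lt0r_neq0// !powRr1//.
by apply: lerD; [apply: ler_piMr|apply: ler_piMr] => //; lra.
Qed.

(** With K = (4 C)^(1/t), this is [powR_young] for K y and [x], divided by 4. Two such terms
    together cost half of [x]. *)
Lemma powR_young_scaled C x y t : 0 <= C -> 0 <= x -> 0 <= y -> 0 < t < 1 ->
  C * (x `^ (1 - t) * y `^ t) <= x / 4 + (4 * C) `^ t^-1 / 4 * y.
Proof.
move=> C0 x0 y0 t01; have /andP[t0 t1] := t01.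
have K0 : 0 <= (4 * C) `^ t^-1 := powR_ge0 _ _.
have := powR_young (mulr_ge0 K0 y0) x0 t01.
rewrite powRM// -powRrM mulVf ?lt0r_neq0// powRr1 ?mulr_ge0//; lra.
Qed.

Lemma powR_le1D x t : 0 <= x -> 0 < t < 1 -> x `^ t <= 1 + x.
Proof.
by move=> x0 t01; have := powR_young x0 ler01 t01; rewrite powR1 mulr1 addrC.
Qed.

(** Write (x + y)^t as (x + y) (x + y)^(t - 1); since t - 1 < 0, z (x + y)^(t - 1) <= z^t for z = x
    and z = y. *)
Lemma powRD_subadd x y t : 0 <= x -> 0 <= y -> 0 < t < 1 ->
  (x + y) `^ t <= x `^ t + y `^ t.
Proof.
move=> x0 y0 /andP[t0 t1]; have [-> |xyN0] := eqVneq (x + y) 0.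
  by rewrite powR0 ?gt_eqF// addr_ge0 ?powR_ge0.
have xy0 : 0 < x + y by rewrite lt_neqAle eq_sym xyN0 addr_ge0.
have le z : 0 <= z <= x + y -> z * (x + y) `^ (t - 1) <= z `^ t.
  move=> /andP[z0 zxy]; rewrite -opprB powRN ler_pdivrMr ?powR_gt0//.
  have {1}-> : z = z `^ t * z `^ (1 - t).
    by rewrite -powRD subrKC ?powRr1// oner_eq0.
  by rewrite ler_wpM2l ?powR_ge0// ge0_ler_powR ?nnegrE ?subr_ge0// ltW.
rewrite -(mulr_powRB1 (ltW xy0) t0) mulrDl.
by apply: lerD; apply: le; lra.
Qed.

(** Tangent bound for a concave power, obtained from Young's inequality s^(1 - q) t^q <= (1 - q) s +
    q t times t^(-q). No derivative is taken, so s = 0 is allowed. *)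
Lemma powR_increment s t q : 0 < t -> 0 <= s <= t -> 0 < q < 1 ->
  (1 - q) * ((t - s) * t `^ (- q)) <= t `^ (1 - q) - s `^ (1 - q).
Proof.
move=> t0 /andP[s0 st] q01; have /andP[q0 q1] := q01.
have q1' : 0 < 1 - q by rewrite subr_gt0.
have := @conjugate_powR R (s `^ (1 - q)) (t `^ q) (1 - q)^-1 q^-1
  (powR_ge0 _ _) (powR_ge0 _ _).
rewrite !invr_gt0 !invrK subrK => /(_ q1' q0 erefl).
rewrite -!powRrM !mulfV ?lt0r_neq0// !powRr1 ?(ltW t0)// => H.
have tq0 : 0 < t `^ (- q) by apply: powR_gt0.
have tE : t `^ (1 - q) = t * t `^ (- q).
  by rewrite powRD ?powRr1 ?(ltW t0)// (gt_eqF t0) implybT.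
have sE : s `^ (1 - q) = (s `^ (1 - q) * t `^ q) * t `^ (- q).
  by rewrite powRN mulfK// gt_eqF// powR_gt0.
rewrite tE sE; nra.
Qed.

(** Discrete integral of s^(-q): [powR_increment] telescopes along [S], the first increment starting
    from 0. *)
Lemma sum_powR_increment (a S : nat -> R) q m : 0 < q < 1 ->
  (forall k, 0 <= a k) -> 0 < S 0%N -> S 0%N = a 0%N ->
  (forall k, S k.+1 = S k + a k.+1) ->
  (1 - q) * \sum_(k < m.+1) a k * S k `^ (- q) <= S m `^ (1 - q).
Proof.
move=> q01 a0 S0 Sa SS; have /andP[q0 q1] := q01.
have Sp k : 0 < S k.
  by elim: k => [//|k IH]; rewrite SS ltr_wpDr.
elim: m => [|m IH].
  have h0 : (0 : R) <= 0 <= S 0%N by rewrite lexx ltW.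
  have := powR_increment S0 h0 q01.
  by rewrite big_ord1 subr0 -Sa powR0 ?subr0// gt_eqF// subr_gt0.
rewrite big_ord_recr mulrDr /=.
have := @powR_increment (S m) (S m.+1) q (Sp _) _ q01.
rewrite SS addrC addrK addrC (ltW (Sp m)) lerDl a0 => /(_ erefl); lra.
Qed.

(** Every weight is at least the last one, and the [a k] add up to [S m]. *)
Lemma le_sum_powR (a S : nat -> R) q m : 0 <= q ->
  (forall k, 0 <= a k) -> 0 < S 0%N -> S 0%N = a 0%N ->
  (forall k, S k.+1 = S k + a k.+1) ->
  S m `^ (1 - q) <= \sum_(k < m.+1) a k * S k `^ (- q).
Proof.
move=> q0 a0 S0 Sa SS.
have Sm k j : S k <= S (k + j)%N.
  elim: j => [|j IH]; first by rewrite addn0.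
  by rewrite addnS SS (le_trans IH)// lerDl.
have Sp k : 0 < S k by apply: lt_le_trans S0 _; rewrite -[k]add0n.
have -> : S m `^ (1 - q) = S m * S m `^ (- q).
  by rewrite powRD ?powRr1 ?(ltW (Sp m))// (gt_eqF (Sp m)) implybT.
have SE : \sum_(k < m.+1) a k = S m.
  by elim: m => [|m IH]; rewrite ?big_ord1// SS -IH big_ord_recr.
rewrite -[X in X * _]SE mulr_suml; apply: ler_sum => k _; rewrite ler_wpM2l//.
rewrite !powRN lef_pV2 ?posrE ?powR_gt0//.
rewrite ge0_ler_powR// ?nnegrE ?(ltW (Sp _))//.
by rewrite -[X in _ <= S X](subnKC (ltnSE (ltn_ord k))).
Qed.

End PowerInequalities.

(** * Error recurrences *)

Section StormPath.
Variables (R : realType) (n d : nat) (f : 'I_n -> 'rV[R]_d -> R) (L : R).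
Hypothesis n_gt0 : (0 < n)%N.
Hypothesis L_gt0 : 0 < L.
Hypothesis f_diff : forall i x, differentiable (f i) x.
Hypothesis f_smooth : forall i x y,
  norm2 (grad (f i) x - grad (f i) y) <= L * norm2 (x - y).
Variables (eta : R -> R) (beta : R) (x1 : 'rV[R]_d).
Implicit Types (idx : nat -> 'I_n) (k : nat).

Let F := average f.
Let st idx k := storm f eta beta x1 idx k.
Let X idx k := storm_x (st idx k).
Let V idx k := storm_v (st idx k).
Let G idx k := storm_g (st idx k).
Let S idx k := storm_sum (st idx k).
Let step idx k := eta (S idx k).

Lemma smooth_sqr i x y :
  norm2 (grad (f i) x - grad (f i) y) ^+ 2 <= L ^+ 2 * norm2 (x - y) ^+ 2.
Proof.
by rewrite -exprMn lerXn2r// nnegrE ?mulr_ge0 ?norm2_ge0// ltW.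
Qed.

Lemma smooth_average_sqr x y :
  norm2 (grad F x - grad F y) ^+ 2 <= L ^+ 2 * norm2 (x - y) ^+ 2.
Proof.
rewrite /F !grad_average// -scalerBr -sumrB.
apply: le_trans (norm2_mean_sqr _ n_gt0) _.
rewrite -[leRHS](mean_cst (Ordinal n_gt0)).
by apply: ler_mean => i; exact: smooth_sqr.
Qed.

Lemma storm_ext idx idx' k : (forall m, (m <= k)%N -> idx m = idx' m) ->
  storm f eta beta x1 idx k = storm f eta beta x1 idx' k.
Proof.
elim: k => [//|k IH] e /=.
by rewrite IH ?e// => m mk; apply: e; exact: leqW.
Qed.

(** The strict bound matters: position and table are fixed before [idx k] is drawn, and only the
    direction and the running sum use it. This stands in for measurability with respect to the
    past. *)
Lemma storm_x_ext idx idx' k : (forall m, (m < k)%N -> idx m = idx' m) ->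
  storm_x (storm f eta beta x1 idx k) = storm_x (storm f eta beta x1 idx' k).
Proof. by case: k => [//|k] e /=; rewrite (@storm_ext idx idx'). Qed.

Lemma storm_g_ext idx idx' k : (forall m, (m < k)%N -> idx m = idx' m) ->
  storm_g (storm f eta beta x1 idx k) = storm_g (storm f eta beta x1 idx' k).
Proof.
by case: k => [//|k] e /=; rewrite (@storm_ext idx idx')// (e k).
Qed.

Lemma storm_gS idx k i : G idx k.+1 i =
  if i == idx k then grad (f i) (X idx k) else G idx k i.
Proof. by rewrite /G /=; case: eqP => [->|]. Qed.

(** With zero direction and a table of gradients at [x1], the next direction is [beta *: grad F x1],
    which is zero again. *)
Lemma storm_stuck idx k : S idx 0 = 0 ->
  [/\ X idx k = x1, V idx k = 0, (forall i, G idx k i = grad (f i) x1) & S idx k = 0].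
Proof.
rewrite /S /= => S0; have F0 := norm2_sqr_eq0 S0.
rewrite /X /V /G; elim: k => [|k [Xk Vk Gk Sk]] /=; first by split.
rewrite /st /= in Xk Vk Gk Sk *; rewrite Sk eqxx Xk Vk.
have gE i : (if i == idx k then grad (f (idx k)) x1
    else storm_g (storm f eta beta x1 idx k) i) = grad (f i) x1.
  by case: eqP => [->|_].
under eq_bigr do rewrite gE.
have V0 : (1 - beta) *: 0 + grad (f (idx k.+1)) x1
    - (1 - beta) *: grad (f (idx k.+1)) x1
    - beta *: ((if idx k.+1 == idx k then grad (f (idx k)) x1
    else storm_g (storm f eta beta x1 idx k) (idx k.+1))
      - n%:R^-1 *: \sum_(i < n) grad (f i) x1) = 0.
  rewrite gE -grad_average// F0; apply/rowP => j; rewrite !mxE; ring.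
by rewrite V0 norm2_0 expr0n addr0.
Qed.

Definition storm_err idx k : 'rV[R]_d := V idx k - grad F (X idx k).
(* The gradients at [x_k] against the table already updated with the index [idx k]. *)
Definition storm_lag idx k : R :=
  mean (fun i => norm2 (grad (f i) (X idx k) - G idx k.+1 i) ^+ 2).

Lemma storm_err0 idx : storm_err idx 0 = 0.
Proof. exact: subrr. Qed.

Lemma storm_lag0 idx : storm_lag idx 0 = 0.
Proof.
rewrite -[RHS](mean_cst (Ordinal n_gt0)); apply: eq_mean => i.
by rewrite storm_gS if_same subrr norm2_0 expr0n.
Qed.

Lemma storm_lag_ge0 idx k : 0 <= storm_lag idx k.
Proof. by apply: mean_ge0 => i; exact: sqr_ge0. Qed.

(** Conditional expectation over the index at [k], with [J] the family of sequences sharing one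
    past. A slot is refreshed with probability 1/n and then contributes nothing. *)
Lemma storm_lag_resample idx k (J : 'I_n -> nat -> 'I_n) :
  (forall j m, (m < k)%N -> J j m = idx m) -> (forall j, J j k = j) ->
  mean (fun j => storm_lag (J j) k) =
  (1 - n%:R^-1) * mean (fun i => norm2 (grad (f i) (X idx k) - G idx k i) ^+ 2).
Proof.
move=> Jlt Jk.
have nu : n%:R != 0 :> R by rewrite pnatr_eq0 -lt0n.
pose D i := norm2 (grad (f i) (X idx k) - G idx k i) ^+ 2.
have E j : storm_lag (J j) k = n%:R^-1 * (\sum_i D i - D j).
  rewrite /storm_lag /mean card_ord; congr (_ * _).
  rewrite (bigD1 j)//= storm_gS Jk eqxx subrr norm2_0 expr0n add0r.
  rewrite [in RHS](bigD1 j)//= addrAC subrr add0r.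
  apply: eq_bigr => i ij; rewrite storm_gS Jk (negbTE ij) /D /X /G /st.
  by rewrite (storm_x_ext (Jlt j)) (storm_g_ext (Jlt j)).
rewrite (eq_mean E) /mean card_ord -mulr_sumr sumrB sumr_const card_ord.
by rewrite -/D; field.
Qed.

Hypothesis eta_ge0 : forall s, 0 < s -> 0 <= eta s.
Hypothesis eta_nincr : forall s t, 0 < s -> s <= t -> eta t <= eta s.
Hypothesis grad_x1 : 0 < norm2 (grad F x1) ^+ 2.

Lemma storm_sum_gt0 idx k : 0 < S idx k.
Proof.
elim: k => [|k IH]; first exact: grad_x1.
by rewrite /S /= ltr_wpDr ?sqr_ge0.
Qed.

Lemma storm_step_ge0 idx k : 0 <= step idx k.
Proof. exact/eta_ge0/storm_sum_gt0. Qed.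

Lemma storm_step_nincr idx k : step idx k.+1 <= step idx k.
Proof. by apply: eta_nincr; [exact: storm_sum_gt0|rewrite /S /= lerDl sqr_ge0]. Qed.

Lemma storm_xS idx k : X idx k.+1 = X idx k - step idx k *: V idx k.
Proof. by rewrite /X /= gt_eqF//; exact: storm_sum_gt0. Qed.

Lemma storm_xS_sqr idx k :
  norm2 (X idx k.+1 - X idx k) ^+ 2 = step idx k ^+ 2 * norm2 (V idx k) ^+ 2.
Proof. by rewrite storm_xS addrAC subrr add0r norm2N norm2Z_sqr. Qed.

(** The gradient at the old point is inserted; the factor [1 + c] is paid later out of the
    contraction in [storm_lag_resample]. *)
Lemma storm_lag_step idx k c : 0 < c ->
  mean (fun i => norm2 (grad (f i) (X idx k.+1) - G idx k.+1 i) ^+ 2) <=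
  (1 + c) * storm_lag idx k +
  (1 + c^-1) * (L ^+ 2 * (step idx k ^+ 2 * norm2 (V idx k) ^+ 2)).
Proof.
move=> c0; rewrite -storm_xS_sqr.
rewrite -[X in _ + X](mean_cst (Ordinal n_gt0)) -meanZ -meanD.
apply: ler_mean => i; rewrite -[_ - G _ _ _](subrKA (grad (f i) (X idx k))) addrC.
apply: le_trans (ler_norm2D_sqr _ _ c0) _.
by rewrite lerD2l ler_wpM2l ?smooth_sqr// addr_ge0// invr_ge0 ltW.
Qed.

Lemma storm_err_resample idx k (J : 'I_n -> nat -> 'I_n) :
  (forall j m, (m <= k)%N -> J j m = idx m) -> (forall j, J j k.+1 = j) ->
  mean (fun j => norm2 (storm_err (J j) k.+1) ^+ 2) <=
  (1 - beta) ^+ 2 * norm2 (storm_err idx k) ^+ 2 +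
  (2 * L ^+ 2 * (step idx k ^+ 2 * norm2 (V idx k) ^+ 2) +
   2 * beta ^+ 2 * storm_lag idx k).
Proof.
move=> Jle Jk.
pose x := X idx k; pose x' := X idx k.+1; pose g := G idx k.+1.
(* The new error is [1 - beta] times the old one plus the centred [Y j]; the two summands are the
   effects of the move and of the stale table. *)
pose Y j := (grad (f j) x' - grad (f j) x) + beta *: (grad (f j) x - g j).
have E j : storm_err (J j) k.+1 =
    (1 - beta) *: storm_err idx k + (Y j - n%:R^-1 *: \sum_i Y i).
  rewrite /storm_err /V /X /st /= Jk.
  rewrite (storm_ext (Jle j)) (Jle j k)//.
  rewrite -[storm_g _]/(G idx k) -[storm_x _]/x -[storm_v _]/(V idx k).
  rewrite -[if _ == 0 then _ else _]/x'.
  have -> : (if j == idx k then grad (f (idx k)) x else G idx k j) = g j by [].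
  rewrite -[\sum_(i < n) (if _ then _ else _)]/(\sum_(i < n) g i).
  rewrite /Y !big_split/= sumrN -scaler_sumr big_split/= sumrN.
  rewrite !(scalerDr, scalerN) /F !grad_average//.
  rewrite [_^-1 *: (beta *: \sum_i grad _ _)]scalerA.
  rewrite [_^-1 *: (beta *: \sum_i g _)]scalerA.
  rewrite [beta *: (_ *: _)]scalerA.
  rewrite [(1 - beta) *: (_ *: _)]scalerA.
  apply/rowP => c; rewrite !mxE.
  ring.
rewrite (eq_mean (fun j => congr1 (fun u => norm2 u ^+ 2) (E j))).
apply: le_trans (mean_norm2_center _ _ n_gt0) _.
rewrite norm2Z_sqr lerD2l -storm_xS_sqr.
rewrite -[X in X + _](mean_cst (Ordinal n_gt0)) -meanZ -meanD.
apply: ler_mean => i; rewrite /Y.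
(* Young's inequality with weight 1, whence the two factors 2. *)
apply: le_trans (ler_norm2D_sqr _ _ ltr01) _.
rewrite norm2Z_sqr invr1 mulrA; apply: lerD; last by rewrite mulrA.
have := smooth_sqr i x' x; rewrite -/x -/x'; lra.
Qed.

(** Polarisation turns the linear term of [descent], a pairing of the gradient with the direction,
    into the squares of the gradient, the direction and the error. *)
Lemma storm_descent idx k :
  step idx k * (norm2 (grad F (X idx k)) ^+ 2 + norm2 (V idx k) ^+ 2) <=
  2 * (F (X idx k) - F (X idx k.+1)) + step idx k * norm2 (storm_err idx k) ^+ 2 +
  L * (step idx k ^+ 2 * norm2 (V idx k) ^+ 2).
Proof.
have dF z : differentiable F z by exact: differentiable_average.
have := @descent R d F L (X idx k) (X idx k.+1) L_gt0 dF smooth_average_sqr.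
have e : X idx k.+1 - X idx k = - step idx k *: V idx k.
  by rewrite storm_xS addrAC subrr add0r scaleNr.
rewrite storm_xS_sqr e dotpZr /storm_err norm2B_sqr (dotpC (V _ _)); lra.
Qed.

Lemma storm_descent_sum idx m : has_lbound (range F) ->
  \sum_(k < m) step idx k * (norm2 (grad F (X idx k)) ^+ 2 + norm2 (V idx k) ^+ 2) <=
  2 * (F x1 - inf (range F)) +
  \sum_(k < m) step idx k * norm2 (storm_err idx k) ^+ 2 +
  L * \sum_(k < m) step idx k ^+ 2 * norm2 (V idx k) ^+ 2.
Proof.
move=> lbF.
suff : \sum_(k < m) step idx k * (norm2 (grad F (X idx k)) ^+ 2 + norm2 (V idx k) ^+ 2) <=
  2 * (F x1 - F (X idx m)) +
  \sum_(k < m) step idx k * norm2 (storm_err idx k) ^+ 2 +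
  L * \sum_(k < m) step idx k ^+ 2 * norm2 (V idx k) ^+ 2.
  have : inf (range F) <= F (X idx m) by apply: ge_inf => //; exists (X idx m).
  by move=> H /le_trans; apply; lra.
elim: m => [|m IH]; first by rewrite !big_ord0 subrr; lra.
rewrite !big_ord_recr /= -/(st _ _); have := storm_descent idx m; lra.
Qed.


(** * Recurrences in mean over uniform index sequences *)

Hypothesis betaE : beta = n%:R^-1.
Variable T : nat.

(** Lets [storm] run on a finite sequence. Beyond [T], [inord] falls back to position 0, a default
    that the states up to time [T] never read. *)
Definition ffun_index (h : {ffun 'I_T.+1 -> 'I_n}) (m : nat) : 'I_n := h (inord m).

(** Tower property: it suffices to average over the index at [k] with the earlier ones frozen. [J]
    is left free after [k], which suits a [phi] that looks no further. *)
Lemma ler_mean_resample (phi psi : (nat -> 'I_n) -> R) k : (k <= T)%N ->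
  (forall idx J, (forall j m, (m < k)%N -> J j m = idx m) -> (forall j, J j k = j) ->
    mean (fun j : 'I_n => phi (J j)) <= psi idx) ->
  mean (phi \o ffun_index) <= mean (psi \o ffun_index).
Proof.
move=> kT le; rewrite (mean_upd (inord k)) ?card_ord//.
apply: ler_mean => h.
apply: (le _ (fun j => ffun_index (upd h (inord k) j))) => [j m mk|j].
  (* As m < k <= T, [inord] is exact at both, so position [m] is not the updated one. *)
  rewrite /ffun_index ffunE; case: eqP => // /(congr1 (@nat_of_ord _)).
  rewrite !inordK ?ltnS ?(leq_trans (ltnW mk))// => e.
  by rewrite e ltnn in mk.
by rewrite /ffun_index ffunE eqxx.
Qed.

Let err2 k := mean (fun h => step (ffun_index h) k * norm2 (storm_err (ffun_index h) k) ^+ 2).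
Let lag k := mean (fun h => step (ffun_index h) k * storm_lag (ffun_index h) k).
(** The cube is the common weight [step] times the squared displacement. *)
Let mv2 k := mean (fun h => step (ffun_index h) k ^+ 3 * norm2 (V (ffun_index h) k) ^+ 2).

Let ninv_gt0 : 0 < n%:R^-1 :> R.
Proof. by rewrite invr_gt0 ltr0n. Qed.

Let ninv_le1 : n%:R^-1 <= 1 :> R.
Proof. by rewrite invf_le1 ?ltr0n// ler1n. Qed.

(** The weight at [k.+1] is first replaced by the larger one at [k], which stays constant while the
    index at [k.+1] is resampled. *)
Lemma err2_recurrence k : (k < T)%N ->
  err2 k.+1 <= (1 - n%:R^-1) * err2 k + 2 * L ^+ 2 * mv2 k + 2 * n%:R^-1 ^+ 2 * lag k.
Proof.
move=> kT; rewrite /err2 /mv2 /lag -!meanZ -!meanD.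
pose phi idx := step idx k * norm2 (storm_err idx k.+1) ^+ 2.
apply: (@le_trans _ _ (mean (phi \o ffun_index))).
  by apply: ler_mean => h; rewrite ler_wpM2r ?sqr_ge0// storm_step_nincr.
pose psi idx := (1 - n%:R^-1) * (step idx k * norm2 (storm_err idx k) ^+ 2) +
  2 * L ^+ 2 * (step idx k ^+ 3 * norm2 (V idx k) ^+ 2) +
  2 * n%:R^-1 ^+ 2 * (step idx k * storm_lag idx k).
apply: (@ler_mean_resample phi psi k.+1) => // idx J Jle Jk.
have stepE j : step (J j) k = step idx k by rewrite /step /S /st (storm_ext (Jle j)).
rewrite /phi; under eq_mean do rewrite stepE.
rewrite meanZ; apply: le_trans (ler_wpM2l (storm_step_ge0 idx k) (storm_err_resample Jle Jk)) _.
rewrite betaE; have := storm_step_ge0 idx k; have n0 := ninv_gt0; have n1 := ninv_le1.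
rewrite /psi; move: (step idx k) (norm2 (storm_err idx k)) (norm2 (V idx k)) (storm_lag idx k) => s e v g s0.
rewrite -subr_ge0.
set b := n%:R^-1 in n0 n1 *.
(* The surplus left by settling for the contraction [1 - b] instead of its square. *)
have -> : (1 - b) * (s * e ^+ 2) + 2 * L ^+ 2 * (s ^+ 3 * v ^+ 2) + 2 * b ^+ 2 * (s * g) -
  s * ((1 - b) ^+ 2 * e ^+ 2 + (2 * L ^+ 2 * (s ^+ 2 * v ^+ 2) + 2 * b ^+ 2 * g)) =
  s * e ^+ 2 * (b * (1 - b)) by ring.
by apply: mulr_ge0; apply: mulr_ge0; rewrite ?sqr_ge0 ?subr_ge0// ltW.
Qed.

Lemma lag_recurrence k : (k < T)%N ->
  lag k.+1 <= (1 - n%:R^-1 / 2) * lag k + 2 * n%:R * L ^+ 2 * mv2 k.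
Proof.
move=> kT; rewrite /mv2 /lag -!meanZ -!meanD.
pose phi idx := step idx k * storm_lag idx k.+1.
apply: (@le_trans _ _ (mean (phi \o ffun_index))).
  by apply: ler_mean => h; rewrite ler_wpM2r ?storm_lag_ge0// storm_step_nincr.
pose psi idx := (1 - n%:R^-1 / 2) * (step idx k * storm_lag idx k) +
  2 * n%:R * L ^+ 2 * (step idx k ^+ 3 * norm2 (V idx k) ^+ 2).
apply: (@ler_mean_resample phi psi k.+1) => // idx J Jle Jk.
have stepE j : step (J j) k = step idx k by rewrite /step /S /st (storm_ext (Jle j)).
rewrite /phi; under eq_mean do rewrite stepE.
rewrite meanZ (storm_lag_resample Jle Jk).
have n0 := ninv_gt0; have n1 := ninv_le1.
(* With c = 1/(2n), (1 - 1/n)(1 + c) <= 1 - 1/(2n) and (1 - 1/n)(1 + 1/c) <= 2n. *)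
have c0 : 0 < n%:R^-1 / 2 :> R by rewrite divr_gt0.
have s0 := storm_step_ge0 idx k.
apply: le_trans (ler_wpM2l s0 (ler_wpM2l _ (storm_lag_step idx k c0))) _.
  by rewrite subr_ge0.
have := storm_lag_ge0 idx k.
rewrite /psi; move: (step idx k) s0 (norm2 (V idx k)) (storm_lag idx k) => s s0 v g g0.
have nE : n%:R = (n%:R^-1)^-1 :> R by rewrite invrK.
rewrite invfM !invrK -subr_ge0; move: nE n0 n1.
set b := n%:R^-1 => -> n0 n1.
have -> : (1 - b / 2) * (s * g) + 2 * b^-1 * L ^+ 2 * (s ^+ 3 * v ^+ 2) -
  s * ((1 - b) * ((1 + b / 2) * g + (1 + b^-1 * 2) * (L ^+ 2 * (s ^+ 2 * v ^+ 2)))) =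
  s * g * (b ^+ 2 / 2) + L ^+ 2 * s ^+ 3 * v ^+ 2 * (1 + b).
  by field; exact: lt0r_neq0.
have b0 := ltW n0; have b1 : 0 <= 1 + b by lra.
apply: addr_ge0; apply: mulr_ge0 => //.
- exact: mulr_ge0.
- by rewrite divr_ge0 ?sqr_ge0.
- by apply: mulr_ge0 (sqr_ge0 _); apply: mulr_ge0 (sqr_ge0 _) _; exact: exprn_ge0.
Qed.

Lemma sum_err2_le :
  \sum_(k < T.+1) err2 k <= 10 * n%:R * L ^+ 2 * \sum_(k < T.+1) mv2 k.
Proof.
have err0 k : 0 <= err2 k.
  by apply: mean_ge0 => h; rewrite mulr_ge0 ?sqr_ge0 ?storm_step_ge0.
have lag_ge0 k : 0 <= lag k.
  by apply: mean_ge0 => h; rewrite mulr_ge0 ?storm_lag_ge0 ?storm_step_ge0.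
have mv0 k : 0 <= mv2 k.
  by apply: mean_ge0 => h; rewrite mulr_ge0 ?sqr_ge0 ?exprn_ge0 ?storm_step_ge0.
have nu : n%:R != 0 :> R by rewrite pnatr_eq0 -lt0n.
have n1 : 1 <= n%:R :> R by rewrite ler1n.
(* The weight 4 makes the lag decay 4/(2n) cancel the 2/n that [n%:R * err2] receives; the constant
   is 10 = 2 + 4 * 2. *)
have potential m : (m <= T)%N ->
    \sum_(k < m) err2 k + (n%:R * err2 m + 4 * lag m) <=
    10 * n%:R * L ^+ 2 * \sum_(k < m) mv2 k.
  elim: m => [_|m IH mT].
    rewrite !big_ord0 /err2 /lag; under eq_mean do rewrite storm_err0 norm2_0 expr0n mulr0.
    under [in X in _ + (_ + 4 * X)]eq_mean do rewrite storm_lag0 mulr0.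
    by rewrite !(mean_cst [ffun=> Ordinal n_gt0]) !mulr0 !addr0.
  rewrite !big_ord_recr/=.
  have := IH (ltnW mT); have := lag_recurrence mT.
  have := err2_recurrence mT; rewrite -(ler_pM2l (lt_le_trans ltr01 n1)).
  have -> : n%:R * ((1 - n%:R^-1) * err2 m + 2 * L ^+ 2 * mv2 m + 2 * n%:R^-1 ^+ 2 * lag m) =
    n%:R * err2 m - err2 m + 2 * (n%:R * L ^+ 2 * mv2 m) + 2 * (n%:R^-1 * lag m).
    by field.
  move: (\sum_(i < m) err2 i) (\sum_(i < m) mv2 i) (err2 m) (err2 m.+1) (lag m) (lag m.+1).
  move: (mv2 m) (n%:R) (n%:R^-1) => v N b A U e e' g g' H1 H2 H3; lra.
rewrite !big_ord_recr/=; have := potential T (leqnn T).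
(* The final summand is covered by what remains in the potential at [T]. *)
have : err2 T <= n%:R * err2 T by rewrite ler_peMl.
have : 0 <= 10 * n%:R * L ^+ 2 * mv2 T by apply: mulr_ge0 => //; apply: mulr_ge0 (sqr_ge0 _); rewrite mulr_ge0.
have := lag_ge0 T; rewrite mulrDr.
move: (err2 T) (lag T) (mv2 T) (\sum_(k < T) err2 k) (\sum_(k < T) mv2 k).
move=> e g v A U H1 H2 H3 H4; lra.
Qed.

End StormPath.

(** * Rate *)

Section Rate.
Variables (R : realType) (alpha : R).
Hypothesis alpha_gt0 : 0 < alpha.
Hypothesis alpha_lt : alpha < 1 / 3.

Let one_alpha : 0 < 1 - alpha.
Proof. have := alpha_lt; have := alpha_gt0; lra. Qed.

Let one_2alpha : 0 < 1 - 2 * alpha.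
Proof. have := alpha_lt; have := alpha_gt0; lra. Qed.

Let one_3alpha : 0 < 1 - 3 * alpha.
Proof. have := alpha_lt; have := alpha_gt0; lra. Qed.

(** Chosen so that S^alpha = (S^(1 - alpha))^rho; the condition 2 rho < 1 is exactly alpha < 1/3. *)
Variable rho : R.
Hypothesis rhoE : rho = alpha / (1 - alpha).

Let rho_gt0 : 0 < rho. Proof. by rewrite rhoE divr_gt0. Qed.
Let two_rho : 2 * rho < 1.
Proof. by rewrite rhoE mulrA ltr_pdivrMr//; have := alpha_lt; lra. Qed.

(* The two powers are the constants with which Young's inequality absorbs the
   terms in S^(1 - 3 alpha) and S^(1 - 2 alpha). *)
Definition rate_const : R :=
  2 + ((4 * (10 / (1 - 3 * alpha))) `^ (2 * rho)^-1 / 4 +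
       (4 * (1 - 2 * alpha)^-1) `^ rho^-1 / 4).

Lemma rate_const_gt0 : 0 < rate_const.
Proof. by rewrite ltr_wpDr// addr_ge0// divr_ge0 ?powR_ge0. Qed.

Variables (n d : nat) (f : 'I_n -> 'rV[R]_d -> R) (L Delta : R) (x1 : 'rV[R]_d).
Hypothesis n_gt0 : (0 < n)%N.
Hypothesis L_gt0 : 0 < L.
Hypothesis Delta_gt0 : 0 < Delta.
Hypothesis f_diff : forall i x, differentiable (f i) x.
Hypothesis f_smooth : forall i x y,
  norm2 (grad (f i) x - grad (f i) y) <= L * norm2 (x - y).
Hypothesis F_bounded : has_lbound (range (average f)).
Hypothesis F_gap : average f x1 - inf (range (average f)) <= Delta.
Hypothesis grad_x1 : 0 < norm2 (grad (average f) x1) ^+ 2.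

(** [M] is the scale of S^(1 - alpha); the exponent [rho^-1] ensures L <= (M / kappa)^rho. *)
Variables kappa M : R.
Hypothesis kappaE : kappa = n%:R `^ ((1 - alpha) / 2).
Hypothesis ME : M = kappa * (Delta + L `^ rho^-1).
Let eta (s : R) : R := 1 / (kappa * s `^ alpha).
Variable T : nat.
Let H : finType := {ffun 'I_T.+1 -> 'I_n}.
Let st (h : H) k := storm f eta n%:R^-1 x1 (ffun_index h) k.
Let S h k := storm_sum (st h k).
Let V h k := storm_v (st h k).
Let gradF h k := grad (average f) (storm_x (st h k)).
Let Y h := S h T `^ (1 - alpha).
Let W h := \sum_(k < T.+1) norm2 (gradF h k) ^+ 2 * S h k `^ (- alpha).

Let kappa_ge1 : 1 <= kappa.
Proof.
have n1 : 1 <= n%:R :> R by rewrite ler1n.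
have e0 : 0 <= (1 - alpha) / 2 by rewrite divr_ge0// ltW.
by have := ler_powR n1 e0; rewrite powRr0 kappaE.
Qed.

Let kappa_gt0 : 0 < kappa. Proof. exact: lt_le_trans kappa_ge1. Qed.

Let base_gt0 : 0 < Delta + L `^ rho^-1.
Proof. by rewrite ltr_wpDr ?powR_ge0. Qed.

Lemma rate_scale_gt0 : 0 < M. Proof. by rewrite ME mulr_gt0. Qed.

Let L_le : L <= (Delta + L `^ rho^-1) `^ rho.
Proof.
rewrite -{1}(powRr1 (ltW L_gt0)) -(mulVf (lt0r_neq0 rho_gt0)) powRrM.
by rewrite ge0_ler_powR ?nnegrE ?powR_ge0 ?(ltW base_gt0) ?(ltW rho_gt0)// lerDr ltW.
Qed.

(** The exponent in [kappa] is tuned for this: n / kappa^2 = n^alpha = kappa^(2 rho). *)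
Let L_sqr_le : n%:R * L ^+ 2 / kappa ^+ 2 <= M `^ (2 * rho).
Proof.
have n0 : 0 < n%:R :> R by rewrite ltr0n.
have -> : n%:R * L ^+ 2 / kappa ^+ 2 = kappa `^ (2 * rho) * L ^+ 2.
  rewrite mulrAC; congr (_ * _).
  rewrite kappaE -powR_mulrn ?powR_ge0// -!powRrM -{1}(powRr1 (ltW n0)) -powRB.
    by congr (_ `^ _); rewrite rhoE; field; rewrite lt0r_neq0.
  by rewrite (gt_eqF n0) implybT.
rewrite ME powRM ?(ltW kappa_gt0) ?(ltW base_gt0)// ler_wpM2l ?powR_ge0//.
by rewrite [2 * rho]mulrC powRrM powR_mulrn ?powR_ge0// lerXn2r// nnegrE ?powR_ge0// ltW.
Qed.

(** Crude in [kappa]: 1 / kappa <= 1 <= kappa^rho. *)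
Let L_kappa_le : L / kappa <= M `^ rho.
Proof.
rewrite ME powRM ?(ltW kappa_gt0) ?(ltW base_gt0)// mulrC.
apply: ler_pM => //; [by rewrite invr_ge0 ltW | exact: ltW |].
apply: (@le_trans _ _ 1); first by rewrite invf_le1.
by have := ler_powR kappa_ge1 (ltW rho_gt0); rewrite powRr0.
Qed.

Let S_gt0 h k : 0 < S h k.
Proof. exact: storm_sum_gt0. Qed.

Let etaE s : 0 < s -> eta s = kappa^-1 * s `^ (- alpha).
Proof. by move=> s0; rewrite /eta powRN div1r invfM. Qed.

Let eta_ge0 s : 0 < s -> 0 <= eta s.
Proof. by move=> s0; rewrite etaE// mulr_ge0 ?powR_ge0// invr_ge0 ltW. Qed.

Let eta_nincr s t : 0 < s -> s <= t -> eta t <= eta s.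
Proof.
move=> s0 st0; have t0 := lt_le_trans s0 st0.
rewrite !etaE// ler_wpM2l ?invr_ge0 ?(ltW kappa_gt0)// !powRN.
rewrite lef_pV2 ?posrE ?powR_gt0//.
by rewrite ge0_ler_powR// ?nnegrE ltW.
Qed.

Let eta_exp h k (j : nat) : eta (S h k) ^+ j = kappa^-1 ^+ j * S h k `^ (- (j%:R * alpha)).
Proof.
by rewrite etaE// exprMn -[in X in _ * X]powR_mulrn ?powR_ge0// -powRrM mulNr (mulrC alpha).
Qed.

(** [sum_powR_increment] with q = j alpha. It serves for j = 2 and j = 3, the latter requiring alpha
    < 1/3. *)
Let sum_eta_le h (j : nat) : (0 < j)%N -> j%:R * alpha < 1 ->
  \sum_(k < T.+1) eta (S h k) ^+ j * norm2 (V h k) ^+ 2 <=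
  kappa^-1 ^+ j * (S h T `^ (1 - j%:R * alpha) / (1 - j%:R * alpha)).
Proof.
move=> j0 j1.
under eq_bigr do rewrite eta_exp -mulrA (mulrC _ (norm2 _ ^+ 2)).
rewrite -mulr_sumr ler_wpM2l ?exprn_ge0 ?invr_ge0 ?(ltW kappa_gt0)//.
rewrite ler_pdivlMr ?subr_gt0// mulrC.
apply: (@sum_powR_increment _ (fun k => norm2 (V h k) ^+ 2)) => //.
- by rewrite j1 mulr_gt0// ltr0n.
- by move=> k; exact: sqr_ge0.
Qed.

(** Multiplied by [kappa], the summed descent inequality controls [W h + Y h]. The smoothness term
    is bounded on each path, the error term only in mean. *)
Lemma mean_storm_potential : mean W + mean Y / 2 <= rate_const * M.
Proof.
pose C1 := 10 / (1 - 3 * alpha); pose C2 := (1 - 2 * alpha)^-1.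
have C10 : 0 <= C1 by rewrite divr_ge0// ltW.
have C20 : 0 <= C2 by rewrite invr_ge0 ltW.
have Y0 h : 0 <= Y h by exact: powR_ge0.
have YE h t : S h T `^ (1 - alpha - t * alpha) = Y h `^ (1 - t * rho).
  by rewrite /Y -powRrM; congr (_ `^ _); rewrite rhoE; field; rewrite lt0r_neq0.
have err_le : mean (fun h => \sum_(k < T.+1) eta (S h k) *
      norm2 (storm_err f eta n%:R^-1 x1 (ffun_index h) k) ^+ 2) <=
    10 * n%:R * L ^+ 2 *
      mean (fun h => \sum_(k < T.+1) eta (S h k) ^+ 3 * norm2 (V h k) ^+ 2).
  rewrite !mean_sum.
  exact: (sum_err2_le n_gt0 L_gt0 f_diff f_smooth eta_ge0 eta_nincr grad_x1 erefl T).
have main : mean W + mean Y <= 2 * M +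
    (mean (fun h => C1 * (Y h `^ (1 - 2 * rho) * M `^ (2 * rho))) +
     mean (fun h => C2 * (Y h `^ (1 - rho) * M `^ rho))).
  pose Eh h := \sum_(k < T.+1) eta (S h k) *
    norm2 (storm_err f eta n%:R^-1 x1 (ffun_index h) k) ^+ 2.
  pose Zh h := \sum_(k < T.+1) eta (S h k) ^+ 3 * norm2 (V h k) ^+ 2.
  have k0 : kappa != 0 by exact: lt0r_neq0.
  have path h : W h + Y h <=
      2 * M + (kappa * Eh h + C2 * (Y h `^ (1 - rho) * M `^ rho)).
    have Yle : Y h <= \sum_(k < T.+1) norm2 (V h k) ^+ 2 * S h k `^ (- alpha).
      apply: (@le_sum_powR _ (fun k => norm2 (V h k) ^+ 2)) => //; first exact: ltW.
      by move=> k; exact: sqr_ge0.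
    have := @storm_descent_sum R n d f L n_gt0 L_gt0 f_diff f_smooth eta n%:R^-1 x1
      grad_x1 (ffun_index h) T.+1 F_bounded.
    rewrite -(ler_pM2l kappa_gt0) => desc.
    apply: le_trans (_ : _ <= kappa * \sum_(k < T.+1) eta (S h k) *
        (norm2 (gradF h k) ^+ 2 + norm2 (V h k) ^+ 2)) _.
      have -> : kappa * \sum_(k < T.+1) eta (S h k) *
          (norm2 (gradF h k) ^+ 2 + norm2 (V h k) ^+ 2) =
          W h + \sum_(k < T.+1) norm2 (V h k) ^+ 2 * S h k `^ (- alpha).
        rewrite mulr_sumr -big_split; apply: eq_bigr => k _ /=.
        by rewrite etaE// !mulrA mulfV// mul1r; ring.
      by rewrite lerD2l.
    apply: le_trans desc _; rewrite -/(Eh h) !mulrDr -addrA; apply: lerD; last apply: lerD => //.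
      rewrite [leLHS](_ : _ = 2 * (kappa * (average f x1 - inf (range (average f))))); last by ring.
      rewrite ler_pM2l// ME ler_pM2l//.
      by apply: le_trans F_gap _; rewrite lerDl powR_ge0.
    have two_lt : 2%:R * alpha < 1 by have := one_2alpha; lra.
    have := @sum_eta_le h 2 isT two_lt.
    have SE : S h T `^ (1 - 2%:R * alpha) = Y h `^ (1 - rho).
      by rewrite -[in RHS](mul1r rho) -YE; congr (_ `^ _); ring.
    rewrite SE => Q.
    have kL : 0 <= kappa * L by rewrite mulr_ge0 ?ltW.
    rewrite mulrA; apply: le_trans (ler_wpM2l kL Q) _.
    rewrite -/C2.
    rewrite [leLHS](_ : _ = C2 * (Y h `^ (1 - rho) * (L / kappa))); last by field.
    by rewrite !ler_wpM2l ?powR_ge0.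
  have Zle h : kappa * (10 * n%:R * L ^+ 2) * Zh h <=
      C1 * (Y h `^ (1 - 2 * rho) * M `^ (2 * rho)).
    have three_lt : 3%:R * alpha < 1 by have := one_3alpha; lra.
    have := @sum_eta_le h 3 isT three_lt.
    have SE : S h T `^ (1 - 3%:R * alpha) = Y h `^ (1 - 2 * rho).
      by rewrite -YE; congr (_ `^ _); ring.
    rewrite SE => Q; have kL : 0 <= kappa * (10 * n%:R * L ^+ 2).
      by apply: mulr_ge0; [exact: ltW|apply: mulr_ge0 (sqr_ge0 _); rewrite mulr_ge0].
    apply: le_trans (ler_wpM2l kL Q) _.
    (* The powers of [kappa] are one from the descent inequality and -3 from the cubed step
       sizes. *)
    rewrite [leLHS](_ : _ = C1 * (Y h `^ (1 - 2 * rho) * (n%:R * L ^+ 2 / kappa ^+ 2))).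
      by rewrite !ler_wpM2l ?powR_ge0.
    by rewrite /C1; field; rewrite k0 lt0r_neq0.
  rewrite -meanD; apply: le_trans (ler_mean path) _.
  rewrite !meanD (mean_cst [ffun=> Ordinal n_gt0]) lerD2l lerD2r meanZ.
  apply: le_trans (ler_wpM2l (ltW kappa_gt0) err_le) _.
  by rewrite mulrA -meanZ; exact: ler_mean.
(* Each of the two uses of [powR_young_scaled] leaves [Y h / 4]; their sum is absorbed on the
   left. *)
apply: le_trans (_ : _ <= 2 * M + mean (fun h => Y h / 2 + (rate_const - 2) * M) - mean Y / 2) _.
  rewrite lerBrDr -addrA -splitr; apply: le_trans main _.
  rewrite lerD2l -meanD; apply: ler_mean => h.
  have t1 : 0 < 2 * rho < 1 by rewrite two_rho mulr_gt0.
  have t2 : 0 < rho < 1 by rewrite rho_gt0/=; have := two_rho; have := rho_gt0; lra.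
  have M0 := ltW rate_scale_gt0.
  have := powR_young_scaled C10 (Y0 h) M0 t1.
  have := powR_young_scaled C20 (Y0 h) M0 t2.
  rewrite /rate_const -/C1 -/C2; lra.
rewrite meanD (mean_cst [ffun=> Ordinal n_gt0]).
under eq_mean do rewrite mulrC.
by rewrite meanZ; lra.
Qed.

Lemma mean_storm_grad :
  T.+1%:R^-1 * \sum_(k < T.+1) mean (fun h => norm2 (gradF h k)) <=
  (1 + 3 * rate_const) / 2 * (n%:R `^ (1 / 4) / T.+1%:R `^ (1 / 2) *
    (Delta `^ (1 / (2 * (1 - alpha))) + L `^ (1 / (2 * alpha)))).
Proof.
set N : R := T.+1%:R; set p := 1 / (2 * (1 - alpha)).
have N0 : 0 < N by rewrite ltr0n.
have M0 := rate_scale_gt0.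
(* [B] is the target rate, and [mu] balances the AM-GM: mu M = N B by definition, and M^rho / mu = B
   because 2 p = 1 + rho. *)
pose B := M `^ p / N `^ (1 / 2); pose mu := B * N / M.
have B0 : 0 < B by rewrite divr_gt0 ?powR_gt0.
have mu0 : 0 < mu by rewrite divr_gt0// mulr_gt0.
have Bsqr : B * B * N = M * M `^ rho.
  have MM : M `^ p * M `^ p = M * M `^ rho.
    rewrite -{3}(powRr1 (ltW M0)) -!powRD ?(gt_eqF M0) ?implybT//.
    by congr (_ `^ _); rewrite /p rhoE; field; exact: lt0r_neq0.
  have NN : N `^ (1 / 2) * N `^ (1 / 2) = N.
    by rewrite -powRD ?(gt_eqF N0) ?implybT// -splitr powRr1// ltW.
  rewrite -MM -[in X in _ * _ * X]NN /B; field.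
  by rewrite lt0r_neq0 ?powR_gt0.
have mu_bal : M `^ rho / mu = B.
  rewrite -[RHS](mulfK (lt0r_neq0 mu0)); congr (_ / _).
  by apply: (mulfI (lt0r_neq0 M0)); rewrite -Bsqr /mu; field; exact: lt0r_neq0.
have path h : \sum_(k < T.+1) norm2 (gradF h k) <=
    mu / 2 * W h + (N * B / 2 + N * B / 2 / M * Y h).
  have Smono : {homo S h : i j / (i <= j)%N >-> i <= j}.
    by apply: homo_leq => // [? ? ?|i]; [exact: le_trans|rewrite /S/= lerDl sqr_ge0].
  have Yrho : Y h `^ rho <= M `^ rho * (1 + Y h / M).
    have YM : 0 <= Y h / M by rewrite divr_ge0 ?powR_ge0 ?ltW.
    have rho1 : 0 < rho < 1 by rewrite rho_gt0/=; have := two_rho; have := rho_gt0; lra.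
    rewrite -{1}(divfK (lt0r_neq0 M0) (Y h)) powRM ?(ltW M0)// mulrC.
    by rewrite ler_wpM2l ?powR_ge0 ?powR_le1D.
  apply: le_trans (_ : _ <= \sum_(k < T.+1) (mu / 2 *
      (norm2 (gradF h k) ^+ 2 * S h k `^ (- alpha)) + B / 2 * (1 + Y h / M))) _; last first.
    rewrite big_split/= -mulr_sumr sumr_const card_ord -[in X in _ + X]mulr_natl -/N.
    by rewrite lerD2l le_eqVlt; apply/orP; left; apply/eqP; field; exact: lt0r_neq0.
  apply: ler_sum => k _.
  have q0 : 0 < S h k `^ (- alpha) by rewrite powR_gt0.
  have qY : (S h k `^ (- alpha))^-1 <= Y h `^ rho.
    rewrite powRN invrK; apply: (@le_trans _ _ (S h T `^ alpha)).
      rewrite ge0_ler_powR// ?nnegrE ?(ltW (S_gt0 _ _)) ?(ltW alpha_gt0)//.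
      by apply: Smono; exact: (ltnSE (ltn_ord k)).
    rewrite /Y -powRrM le_eqVlt; apply/orP; left; apply/eqP.
    by congr (_ `^ _); rewrite rhoE; field; exact: lt0r_neq0.
  move: (norm2 _) (S h k `^ _) q0 qY => g q q0 qY.
  have : (mu * q)^-1 <= B * (1 + Y h / M).
    rewrite invfM -mu_bal [leRHS]mulrAC [leLHS]mulrC ler_wpM2r ?invr_ge0 ?(ltW mu0)//.
    exact: le_trans qY Yrho.
  (* Expanded, this is the weighted AM-GM 2 g <= mu q g^2 + 1 / (mu q). *)
  have : 0 <= (mu * q)^-1 * (mu * q * g - 1) ^+ 2.
    by rewrite mulr_ge0 ?sqr_ge0// invr_ge0 ltW// mulr_gt0.
  have -> : (mu * q)^-1 * (mu * q * g - 1) ^+ 2 = mu * (g ^+ 2 * q) - 2 * g + (mu * q)^-1.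
    by field; rewrite !lt0r_neq0.
  lra.
have W0 : 0 <= mean W.
  by apply: mean_ge0 => h; apply: sumr_ge0 => k _; rewrite mulr_ge0 ?sqr_ge0 ?powR_ge0.
have Y0 : 0 <= mean Y by apply: mean_ge0 => h; exact: powR_ge0.
rewrite -mean_sum; apply: (@le_trans _ _ ((1 + 3 * rate_const) / 2 * B)).
  rewrite mulrC ler_pdivrMr//; apply: le_trans (ler_mean path) _.
  rewrite !meanD !meanZ (mean_cst [ffun=> Ordinal n_gt0]).
  have := mean_storm_potential.
  move: (mean W) (mean Y) W0 Y0 => w y w0 y0 pot.
  have wle : w <= rate_const * M by apply: le_trans pot; rewrite lerDl divr_ge0.
  have yle : y <= rate_const * M * 2.
    by rewrite -ler_pdivrMr//; apply: le_trans pot; rewrite lerDr.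
  have mu2 : 0 <= mu / 2 by rewrite ltW// divr_gt0.
  have NB : 0 <= N * B / 2 / M by rewrite ltW// divr_gt0// divr_gt0// mulr_gt0.
  (* With c for [rate_const], w <= c M and y <= 2 c M give N B (c/2 + 1/2 + c). *)
  apply: le_trans (lerD (ler_wpM2l mu2 wle) (lerD (lexx _) (ler_wpM2l NB yle))) _.
  by rewrite le_eqVlt /mu; apply/orP; left; apply/eqP; field; exact: lt0r_neq0.
rewrite ler_wpM2l//; first by rewrite divr_ge0// addr_ge0// mulr_ge0// ltW ?rate_const_gt0.
rewrite /B mulrAC ler_wpM2r ?invr_ge0 ?powR_ge0//.
rewrite ME powRM ?(ltW kappa_gt0) ?(ltW base_gt0)//.
(* Here p < 1 amounts to alpha < 1/2, and it permits splitting the power of the sum. The final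
   exponents are p (1 - alpha)/2 = 1/4 and p / rho = 1/(2 alpha). *)
have p01 : 0 < p < 1.
  rewrite /p mul1r invr_gt0 mulr_gt0//= invf_lt1 ?mulr_gt0//; have := alpha_lt; lra.
have -> : kappa `^ p = n%:R `^ (1 / 4).
  by rewrite kappaE -powRrM; congr (_ `^ _); rewrite /p; field; exact: lt0r_neq0.
rewrite ler_wpM2l ?powR_ge0//.
apply: le_trans (powRD_subadd (ltW Delta_gt0) (powR_ge0 _ _) p01) _.
rewrite lerD2l -powRrM le_eqVlt; apply/orP; left; apply/eqP.
by congr (_ `^ _); rewrite /p rhoE; field; rewrite !lt0r_neq0.
Qed.

End Rate.

Theorem theorem4 (R : realType) (alpha : R)
    (alpha_gt0 : 0 < alpha) (alpha_lt : alpha < 1 / 3) :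
  exists2 c : R, 0 < c &
  forall (n T : nat) (n_ge1 : (1 <= n)%N) (T_ge1 : (1 <= T)%N)
    (DeltaF L : R) (DeltaF_gt0 : 0 < DeltaF) (L_gt0 : 0 < L)
    (d : nat) (f : 'I_n -> 'rV[R]_d -> R)
    (f_diff : forall (i : 'I_n) (x : 'rV[R]_d), differentiable (f i) x)
    (f_smooth : forall (i : 'I_n) (x y : 'rV[R]_d),
      norm2 (grad (f i) x - grad (f i) y) <= L * norm2 (x - y))
    (F_bounded : has_lbound (range (average f)))
    (x1 : 'rV[R]_d)
    (F_gap : average f x1 - inf (range (average f)) <= DeltaF)
    (disp : measure_display) (Omega : measurableType disp)
    (P : probability Omega R)
    (idx : nat -> Omega -> 'I_n) (tau : Omega -> 'I_T)
    (idx_unif : forall k : nat, (k < T)%N -> uniform_rv P (idx k))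
    (idx_indep : forall k : nat, (k < T)%N ->
      independent_rv P (idx k) (history idx k))
    (tau_unif : uniform_rv P tau)
    (tau_indep : independent_rv P tau (history idx T)),
  let eta := fun S : R =>
    1 / (n%:R `^ ((1 - alpha) / 2) * S `^ alpha) in
  let x := fun (k : nat) (w : Omega) =>
    storm_x (storm f eta n%:R^-1 x1 (fun s => idx s w) k) in
  ('E_P[fun w => norm2 (grad (average f) (x (tau w) w))] <=
   (c * (n%:R `^ (1 / 4) / T%:R `^ (1 / 2)
         * (DeltaF `^ (1 / (2 * (1 - alpha)))
            + L `^ (1 / (2 * alpha)))))%:E)%E.
Proof.
exists ((1 + 3 * rate_const alpha (alpha / (1 - alpha))) / 2).
  by rewrite divr_gt0// addr_gt0// mulr_gt0//; exact: rate_const_gt0.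
move=> n T n_ge1 T_ge1 DeltaF L DeltaF_gt0 L_gt0 d f f_diff f_smooth F_bounded x1 F_gap.
move=> disp Omega P idx tau idx_unif idx_indep tau_unif tau_indep.
cbv zeta; set eta := (fun S : R => _).
case: T T_ge1 tau idx_unif idx_indep tau_unif tau_indep => [//|T] _ tau
  idx_unif idx_indep tau_unif tau_indep.
have joint_unif := uniform_rv_pair tau_unif (uniform_history idx_unif idx_indep) tau_indep.
pose phi (p : 'I_T.+1 * {ffun 'I_T.+1 -> 'I_n}) :=
  norm2 (grad (average f) (storm_x (storm f eta n%:R^-1 x1 (ffun_index p.2) p.1))).
have -> : (fun w => norm2 (grad (average f)
      (storm_x (storm f eta n%:R^-1 x1 (fun s => idx s w) (tau w))))) =
    (fun w => phi (tau w, history idx T.+1 w)).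
  apply/funext => w; rewrite /phi /=; congr (norm2 (grad _ _)).
  (* The position at time [tau w] uses only earlier indices, all recorded in the history, where
     [inord] is exact. *)
  apply: storm_x_ext => m mtau.
  by rewrite /ffun_index ffunE inordK//; exact: ltn_trans mtau (ltn_ord _).
rewrite (expectation_uniform joint_unif); last by move=> p; exact: norm2_ge0.
rewrite lee_fin mean_pair.
(* The rate argument needs positive running sums; a zero initial gradient is settled by
   [storm_stuck], the left side being zero. *)
have [grad0|grad0] := eqVneq (norm2 (grad (average f) x1) ^+ 2) 0.
  rewrite (_ : mean _ = 0).
    rewrite !mulr_ge0 ?divr_ge0 ?addr_ge0 ?mulr_ge0 ?powR_ge0//.
    exact/ltW/rate_const_gt0.
  rewrite -[RHS](mean_cst (ord0 : 'I_T.+1)); apply: eq_mean => k.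
  rewrite -[RHS](@mean_cst R {ffun 'I_T.+1 -> 'I_n} [ffun=> Ordinal n_ge1]); apply: eq_mean => h.
  have sum0 : storm_sum (storm f eta n%:R^-1 x1 (ffun_index h) 0) = 0 := grad0.
  have [Xk _ _ _] := storm_stuck f_diff k sum0.
  by rewrite /phi Xk (norm2_sqr_eq0 grad0) norm2_0.
have grad_gt0 : 0 < norm2 (grad (average f) x1) ^+ 2 by rewrite lt0r grad0 sqr_ge0.
rewrite /mean card_ord.
exact: (mean_storm_grad alpha_gt0 alpha_lt erefl n_ge1 L_gt0 DeltaF_gt0 f_diff f_smooth
  F_bounded F_gap grad_gt0 erefl erefl T).
Qed.
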